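(* The cycle index of the $4$-group $S_9^{(4)}$ of the symmetric group $S_9$, i.e. of the action of $S_9$ on the $126$ four-element subsets of $\{1,\dots,9\}$, in the variables $a_1,a_2,\dots$, is \begin{align*} Z(S_9^{(4)}) = \frac{1}{9!} \big(& a_{1}^{126} + 36 a_{1}^{56} a_{2}^{35} + 378 a_{1}^{26} a_{2}^{50} + 168 a_{1}^{21} a_{3}^{35} + 1260 a_{1}^{12} a_{2}^{57} \\ & + 2520 a_{1}^{11} a_{2}^{5} a_{3}^{15} a_{6}^{10} + 945 a_{1}^{6} a_{2}^{60} + 756 a_{1}^{6} a_{2}^{10} a_{4}^{25} + 3360 a_{1}^{6} a_{3}^{40} \\ & + 7560 a_{1}^{5} a_{2}^{8} a_{3}^{7} a_{6}^{14} + 7560 a_{1}^{4} a_{2}^{11} a_{4}^{25} + 15120 a_{1}^{3} a_{2} a_{3} a_{4}^{4} a_{6}^{3} a_{12}^{7} \\ & + 2520 a_{1}^{3} a_{2}^{9} a_{3}^{3} a_{6}^{16} + 11340 a_{1}^{2} a_{2}^{12} a_{4}^{25} + 10080 a_{1}^{2} a_{2}^{2} a_{3}^{18} a_{6}^{11} \\ & + 11340 a_{1}^{2} a_{2}^{2} a_{4}^{30} + 9072 a_{1} a_{5}^{5} a_{10}^{10} + 18144 a_{1} a_{5}^{11} a_{10}^{7} \\ & + 18144 a_{1} a_{5} a_{10}^{2} a_{20}^{5} + 15120 a_{1} a_{2}^{2} a_{3} a_{4}^{4} a_{6}^{3} a_{12}^{7} + 24192 a_{1} a_{5}^{4} a_{15}^{7}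 \\ & + 3024 a_{1} a_{5}^{25} + 25920 a_{7}^{8} a_{14}^{5} + 10080 a_{2}^{3} a_{3}^{4} a_{6}^{18} + 30240 a_{2}^{3} a_{3}^{2} a_{6}^{19} \\ & + 45360 a_{2} a_{4} a_{8}^{15} + 2240 a_{3}^{42} + 20160 a_{3}^{4} a_{6}^{19} + 25920 a_{7}^{18} + 40320 a_{9}^{14}\big). \end{align*}
   Context: For a permutation group $A$ on a finite set, and $\alpha\in A$, let $j_k(\alpha)$ be the number of cycles of length $k$ in the disjoint cycle decomposition of $\alpha$ (fixed points counted as cycles of length $1$). The cycle index of $A$ is the polynomial $Z(A)=\frac{1}{|A|}\sum_{\alpha\in A}\prod_{k} a_k^{j_k(\alpha)}$ in the variables $a_1,a_2,\dots$ with rational coefficients. For $1\le r\le p$, $S_p^{(r)}$ (the $r$-group of $S_p$) is the permutation group on the set of $r$-element subsets of $\{1,\dots,p\}$ formed by the permutations $\alpha'$ induced by $\alpha\in S_p$ via $\alpha'\{i_1,\dots,i_r\}=\{\alpha i_1,\dots,\alpha i_r\}$. *)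

(* Defs.v *)
From mathcomp Require Export all_boot all_order all_algebra all_fingroup.
From mathcomp Require Export monalg.

Set Implicit Arguments.
Unset Strict Implicit.
Unset Printing Implicit Defensive.

Import GRing.Theory.
Local Open Scope ring_scope.

(* Polynomials in countably many variables: the monoid algebra, over rat, of
   the free commutative monoid on nat.  The variable of index 0 never occurs
   in a cycle index. *)
Definition cycle_var (k : nat) : {malg rat[{cmonom nat}]} := << ucm k >>.

Notation "''a_' k" := (cycle_var k)
  (at level 0, k at level 2, format "''a_' k") : ring_scope.

Section CycleIndex.
Variable T : finType.

(* Fixed points of s are singleton orbits, hence cycles of length 1. *)
Definition cycle_count (s : {perm T}) (k : nat) : nat :=
  #|[set C in porbits s | #|C| == k]|.

(* No cycle is longer than #|T|, so the product stops there. *)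
Definition cycle_index (A : {group {perm T}}) : {malg rat[{cmonom nat}]} :=
  (#|A|%:R : rat)^-1 *:
    \sum_(s in A) \prod_(1 <= k < #|T|.+1) 'a_k ^+ cycle_count s k.

End CycleIndex.

(* 'I_p = {0, ..., p - 1} plays the role of {1, ..., p}. *)
Notation rsubset p r := {S : {set 'I_p} | #|S| == r}.

Section RGroup.
Variables p r : nat.

Fact rimage_subproof (s : 'S_p) (S : rsubset p r) : #|s @: val S| == r.
Proof. by rewrite card_imset ?(valP S) //; apply: perm_inj. Qed.

Definition rimage (s : 'S_p) (S : rsubset p r) : rsubset p r :=
  Sub (s @: val S) (rimage_subproof s S).

Fact rimage_inj (s : 'S_p) : injective (rimage s).
Proof.
move=> S1 S2 /(congr1 val); rewrite !SubK => eqS.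
by apply: val_inj; apply: (imset_inj (@perm_inj _ s)).
Qed.

Definition induced_perm (s : 'S_p) : {perm rsubset p r} := perm (@rimage_inj s).

Definition rgroup_set : {set {perm rsubset p r}} := induced_perm @: [set: 'S_p].

Fact rgroup_group_set : group_set rgroup_set.
Proof.
apply/group_setP; split=> [|_ _ /imsetP[s _ ->] /imsetP[t _ ->]].
  apply/imsetP; exists 1%g => //; apply/permP => S.
  rewrite perm1 permE; apply: val_inj; rewrite SubK.
  by rewrite (eq_imset (g := id)) ?imset_id // => i; rewrite perm1.
apply/imsetP; exists (s * t)%g => //; apply/permP => S.
rewrite permM !permE; apply: val_inj; rewrite !SubK -imset_comp.
by apply: eq_imset => i; rewrite permM.
Qed.

Definition rgroup : {group {perm rsubset p r}} := Group rgroup_group_set.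

End RGroup.

(* Main.v *)
(* The cycle type of the permutation induced on r-subsets is determined by the
   numbers of r-subsets fixed by the powers of s: a subset is fixed by s^d iff
   it is a union of cycles of s^d, and a cycle of s of length k splits into
   gcd(k, d) cycles of s^d of length k / gcd(k, d).  The multiplicities of the
   cycle types of S_(n+1) follow from those of S_n by inserting a new point,
   either as a fixed point or in front of one of the k points of a cycle of
   length k. *)
Require Import Defs.
From mathcomp Require Import zify.

Set Implicit Arguments.
Unset Strict Implicit.
Unset Printing Implicit Defensive.

Import GRing.Theory.
Local Open Scope nat_scope.

(** * Cycle lengths of a permutation and of its powers *)

Definition orbit_sizes (T : finType) (s : {perm T}) : seq nat :=
  [seq #|pred_of_set C| | C <- enum (porbits s)].

Section OrbitSizes.
Variable T : finType.
Implicit Types (s : {perm T}) (x : T).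

Lemma cycle_countE s k : cycle_count s k = count_mem k (orbit_sizes s).
Proof.
rewrite /cycle_count /orbit_sizes count_map cardE -size_filter.
rewrite /enum_mem -filter_predI; congr (size _); apply: eq_filter => C.
by rewrite !inE /= andbC.
Qed.

(** Points are grouped by orbit: an orbit of size [k] contributes [k] equal terms. The values lie in
    a general monoid so that cycle monomials can be summed as well as numbers. *)
Lemma big_orbit_sizes (V : nmodType) s (F : nat -> V) :
  (\sum_x F #|porbit s x| = \sum_(k <- orbit_sizes s) F k *+ k)%R.
Proof.
rewrite big_map big_enum /=.
rewrite (partition_big (porbit s) (mem (porbits s))) /=; last first.
  by move=> x _; apply: imset_f.
apply: eq_bigr => _ /imsetP[x _ ->].
rewrite -sumr_const; apply: eq_big => [y|y /eqP->//].
by rewrite eq_porbit_mem.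
Qed.

Lemma sum_orbit_sizes s (F : nat -> nat) :
  \sum_x F #|porbit s x| = \sum_(k <- orbit_sizes s) k * F k.
Proof.
rewrite [LHS](big_orbit_sizes (V := nat)).
by apply: eq_bigr => k _; rewrite -mulr_natl natn.
Qed.

Lemma orbit_sizes_gt0 s : 0 \notin orbit_sizes s.
Proof.
apply/mapP => -[C]; rewrite mem_enum => /imsetP[x _ ->] /esym/eqP.
by rewrite (negPf (card_porbit_neq0 s x)).
Qed.

(** Exactly [m] times the multiplicity of [m] points lie in orbits of size [m], so these point
    counts determine every multiplicity with [m > 0]; they say nothing about [m = 0], which is why
    zero entries are excluded from [l]. *)
Lemma orbit_sizes_perm s (l : seq nat) : 0 \notin l ->
    (forall m, \sum_x (#|porbit s x| == m) = m * count_mem m l) ->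
  perm_eq (orbit_sizes s) l.
Proof.
move=> l0 Hl; apply/allP => m _; apply/eqP => /=.
have [->|m0] := posnP m.
  by rewrite !(count_memPn _) ?orbit_sizes_gt0.
apply/eqP; rewrite -(eqn_pmul2l m0) -Hl.
rewrite (sum_orbit_sizes s (fun k => (k == m) : nat)) -sumn_count big_map sumnE.
rewrite big_map big_distrr; apply/eqP; rewrite /orbit_sizes big_map.
by apply: eq_bigr => C _ /=; case: eqP => [->|_]; lia.
Qed.

(** The exponent matters only modulo the length [k] of the cycle through [x], and the first [k]
    iterates of [x] are distinct. *)
Lemma permX_fix s d x : ((s ^+ d)%g x == x) = (#|porbit s x| %| d).
Proof.
set k := #|porbit s x|.
have k0 : 0 < k by rewrite lt0n card_porbit_neq0.
have kx : (s ^+ k)%g x = x by rewrite permX iter_porbit.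
have kxm m : (s ^+ (m * k))%g x = x.
  by elim: m => [|m IHm]; rewrite ?perm1 // mulSn expgD permM kx.
have lt_dk : d %% k < k by rewrite ltn_mod.
rewrite {1}(divn_eq d k) expgD permM kxm permX.
rewrite -(nth_traject s lt_dk) -[X in _ == X](nth_traject s k0).
by rewrite nth_uniq ?size_traject ?uniq_traject_porbit.
Qed.

Lemma card_fixX s d :
  #|[set x | (s ^+ d)%g x == x]| = \sum_(k <- orbit_sizes s | k %| d) k.
Proof.
rewrite -sum1_card big_mkcond [RHS]big_mkcond /=.
under eq_bigr do rewrite inE permX_fix.
rewrite (sum_orbit_sizes s (fun k => if k %| d then 1 else 0)).
by apply: eq_bigr => k _; case: ifP => _; lia.
Qed.

(** Both sides have the same multiples: by [permX_fix], the left side divides [e] iff [k] divides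
    [d * e], that is, iff [k / gcd(k, d)] divides [e], where [k] is the size of the orbit under
    [s]. *)
Lemma card_porbitX s d x :
  #|porbit (s ^+ d)%g x| = #|porbit s x| %/ gcdn #|porbit s x| d.
Proof.
have dvdE e : (#|porbit (s ^+ d)%g x| %| e) =
              (#|porbit s x| %/ gcdn #|porbit s x| d %| e).
  rewrite -permX_fix -expgM permX_fix.
  set k := #|porbit s x|; set g := gcdn k d.
  have g0 : 0 < g by rewrite gcdn_gt0 lt0n card_porbit_neq0.
  rewrite -[RHS](dvdn_pmul2r g0) divnK ?dvdn_gcdl //.
  by rewrite /g muln_gcdr dvdn_gcd (dvdn_mull _ (dvdnn k)) mulnC.
by apply/eqP; rewrite eqn_dvd dvdE dvdnn -dvdE dvdnn.
Qed.

Definition power_sizes d (l : seq nat) : seq nat :=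
  flatten [seq nseq (gcdn k d) (k %/ gcdn k d) | k <- l].

Lemma power_sizesP s d :
  perm_eq (orbit_sizes (s ^+ d)%g) (power_sizes d (orbit_sizes s)).
Proof.
apply: orbit_sizes_perm => [|m].
  apply/negP => /flattenP[_ /mapP[k sk ->]].
  rewrite mem_nseq => /andP[g0].
  have k0 : 0 < k by case: k sk {g0} => //; rewrite (negPf (orbit_sizes_gt0 s)).
  have : gcdn k d <= k by rewrite dvdn_leq ?dvdn_gcdl.
  by rewrite -divn_gt0 // lt0n eq_sym => /negPf->.
under eq_bigr do rewrite card_porbitX.
rewrite (sum_orbit_sizes s (fun k => (k %/ gcdn k d == m) : nat)).
rewrite count_flatten -map_comp sumnE big_map big_distrr /=.
apply: eq_bigr => k _; rewrite count_nseq /=.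
by case: eqP => [<-|_]; rewrite ?muln0 // mul1n mulnC divnK ?mul1n // dvdn_gcdl.
Qed.

End OrbitSizes.

(** * Invariant subsets as unions of cycles, counted by subset sums *)

Fixpoint subset_sums (l : seq nat) (r : nat) : nat :=
  if l is k :: l' then
    subset_sums l' r + (if k <= r then subset_sums l' (r - k) else 0)
  else r == 0.

(** The generating function is symmetric in the entries of [l], which makes the recursive count
    independent of their order. *)
Lemma subset_sumsE l r :
  subset_sums l r = ((\prod_(k <- l) (1 + 'X^k) : {poly nat})`_r)%R.
Proof.
elim: l r => [|k l IHl] r; first by rewrite big_nil coef1 natn.
by rewrite big_cons mulrC mulrDr mulr1 coefD coefMXn /= -!IHl ltnNge; case: leqP.
Qed.

Lemma perm_subset_sums l1 l2 :
  perm_eq l1 l2 -> subset_sums l1 =1 subset_sums l2.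
Proof. by move=> eq_l r; rewrite !subset_sumsE (perm_big _ eq_l). Qed.

(** The induction follows the recursion of [subset_sums]: either [J] avoids the head [x], or
    removing [x] from [J] lowers the target sum by [w x]. *)
Lemma card_subset_sums (I : finType) (w : I -> nat) (e : seq I) r : uniq e ->
  #|[set J : {set I} | J \subset e & \sum_(i in J) w i == r]|
    = subset_sums (map w e) r.
Proof.
elim: e r => [|x e IHe] r /=.
  move=> _; case: r => [|r].
    rewrite -[RHS](cards1 (set0 : {set I})).
    apply: eq_card => J; rewrite !inE; apply/andP/eqP => [[/subsetP J0 _]|->].
      by apply/setP => i; rewrite inE; apply/negP => /J0.
    by rewrite big_set0; split=> //; apply/subsetP => i; rewrite inE.
  apply/eqP; rewrite cards_eq0; apply/eqP/setP => J; rewrite !inE.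
  apply/negP => /andP[/subsetP J0]; rewrite big1 // => i /J0 //.
move=> /andP[xe Ue]; rewrite -!IHe // addnC.
rewrite -[LHS](cardsID [set J : {set I} | x \in J]); congr (_ + _); last first.
  apply: eq_card => J; rewrite !inE; case xJ: (x \in J) => /=.
    apply/esym/negP => /andP[/subsetP/(_ x xJ)].
    by rewrite (negPf xe).
  congr (_ && _); apply/subsetP/subsetP => sJ i iJ; last by rewrite inE sJ ?orbT.
  by have := sJ i iJ; rewrite inE => /predU1P[ix|//]; rewrite -ix iJ in xJ.
case: leqP => [le_wr|lt_rw]; last first.
  apply/eqP; rewrite cards_eq0; apply/eqP/setP => J; rewrite !inE.
  apply/negP => /andP[/andP[_ /eqP sumJ] xJ].
  by rewrite (big_setD1 x xJ) /= in sumJ; lia.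
set B := [set J : {set I} | J \subset e & _].
have xB (J : {set I}) : J \in B -> x \notin J.
  by rewrite inE => /andP[/subsetP sJ _]; apply: contra xe => /sJ.
have /card_in_imset <- : {in B &, injective (fun J => x |: J)}.
  by move=> J1 J2 /xB xJ1 /xB xJ2 eqJ; rewrite -(setU1K xJ1) eqJ setU1K.
apply: eq_card => J; rewrite !inE; apply/idP/imsetP => [|[J' J'B ->]].
  move=> /andP[/andP[/subsetP sJ /eqP sumJ] xJ].
  exists (J :\ x); last by rewrite setD1K.
  rewrite (big_setD1 x xJ) /= in sumJ.
  rewrite inE; apply/andP; split; last by apply/eqP; lia.
  by apply/subsetP => i; rewrite !inE => /andP[/negPf ix /sJ]; rewrite inE ix.
have xJ' := xB _ J'B; move: J'B; rewrite inE => /andP[/subsetP sJ /eqP sumJ].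
rewrite setU11 andbT big_setU1 //= sumJ subnKC // eqxx andbT.
by apply/subsetP => i; rewrite !inE => /predU1P[->|/sJ ->]; rewrite ?eqxx ?orbT.
Qed.

(** An invariant set is a union of orbits, and the orbits are disjoint and nonempty. Hence [cover]
    is a bijection from sets of orbits of total size [r] to invariant [r]-subsets. *)
Lemma card_invariant_subsets (T : finType) (s : {perm T}) r :
  #|[set S : {set T} | #|S| == r & s @: S == S]| = subset_sums (orbit_sizes s) r.
Proof.
rewrite -card_subset_sums ?enum_uniq //.
set B := [set J : {set {set T}} | _ & _].
have mem_cov (J : {set {set T}}) x : J \in B ->
    (x \in cover J) = (porbit s x \in J).
  rewrite inE => /andP[/subsetP sJ _]; apply/bigcupP/idP => [[C CJ xC]|xJ].
    have := sJ C CJ; rewrite mem_enum => /imsetP[y _ eC].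
    by move: xC CJ; rewrite eC -eq_porbit_mem => /eqP->.
  by exists (porbit s x); rewrite ?porbit_id.
have mem_orb (J : {set {set T}}) C : J \in B -> C \in J ->
    exists x, C = porbit s x.
  rewrite inE => /andP[/subsetP sJ _] /sJ; rewrite mem_enum => /imsetP[x _ ->].
  by exists x.
have card_cov (J : {set {set T}}) : J \subset porbits s ->
   #|cover J| = \sum_(C in J) #|C|.
  move=> sJ; apply/esym/eqP; apply/trivIsetP.
  move=> C1 C2 /(subsetP sJ) /imsetP[x _ ->] /(subsetP sJ) /imsetP[y _ ->] ne.
  rewrite -setI_eq0; apply: contraNT ne => /set0Pn[z].
  by rewrite inE -!eq_porbit_mem => /andP[/eqP<- /eqP<-].
have /card_in_imset <- : {in B &, injective (fun J => cover J)}.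
  move=> J1 J2 BJ1 BJ2 /setP eqJ; apply/setP => C.
  by apply/idP/idP => CJ; [have [x eC] := mem_orb J1 C BJ1 CJ
    | have [x eC] := mem_orb J2 C BJ2 CJ];
    move: CJ; rewrite eC -!mem_cov // eqJ.
apply: eq_card => S; rewrite inE; apply/idP/imsetP.
  move=> /andP[/eqP Sr /eqP sS].
  have closed i x : x \in S -> (s ^+ i)%g x \in S.
    elim: i => [|i IHi] xS; first by rewrite perm1.
    by rewrite expgSr permM -sS imset_f ?IHi.
  pose J := [set C in porbits s | C \subset S].
  have covJ : S = cover J.
    apply/setP => x; apply/idP/bigcupP => [xS|[C]]; last first.
      by rewrite inE => /andP[_ /subsetP]; apply.
    exists (porbit s x); last exact: porbit_id.
    rewrite inE imset_f //=; apply/subsetP => _ /porbitP[i ->].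
    exact: closed.
  have sJ : J \subset porbits s by apply/subsetP => C; rewrite inE => /andP[].
  exists J => //; rewrite inE -card_cov // -covJ Sr eqxx andbT.
  by apply/subsetP => C /(subsetP sJ); rewrite mem_enum.
move=> [J BJ ->]; have sJ : J \subset porbits s.
  by apply/subsetP => C /(mem_orb J C BJ)[x ->]; apply: imset_f.
rewrite card_cov //; move: (BJ); rewrite inE => /andP[_ ->] /=.
rewrite eqEcard (card_imset _ (@perm_inj _ s)) leqnn andbT.
apply/subsetP => _ /imsetP[x xJ ->]; rewrite mem_cov //.
by have := porbit_perm s 1 x; rewrite expg1 => ->; rewrite -mem_cov.
Qed.

(** * Insertion of a new point into a permutation *)

(* The cycle structure of [insert_perm t j] is that of [t] with the new point
   [ord0] inserted in front of [j], or as a fixed point if [j = ord0]. *)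
Definition insert_perm n (t : 'S_n) (j : 'I_n.+1) : 'S_n.+1 :=
  (lift_perm ord0 ord0 t * tperm ord0 j)%g.

Lemma porbit_sub (T : finType) (s : {perm T}) (A : {set T}) x :
  x \in A -> {in A, forall y, s y \in A} -> porbit s x \subset A.
Proof.
move=> xA sA; apply/subsetP => _ /porbitP[i ->].
elim: i => [|i IHi]; first by rewrite perm1.
by rewrite expgSr permM sA.
Qed.

Section InsertPerm.
Variable n : nat.
Implicit Types (t : 'S_n) (j : 'I_n.+1) (i k : 'I_n).

Lemma insert_perm0 t j : insert_perm t j ord0 = j.
Proof. by rewrite permM lift_perm_id tpermL. Qed.

Lemma insert_perm_lift t j i :
  insert_perm t j (lift ord0 i) =
  if lift ord0 (t i) == j then ord0 else lift ord0 (t i).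
Proof.
rewrite permM lift_perm_lift; case: eqP => [->|ne]; first exact: tpermR.
by rewrite tpermD // ?neq_lift // eq_sym; apply/eqP.
Qed.

Lemma lift_porbit_insert t j i :
  lift ord0 @: porbit t i \subset porbit (insert_perm t j) (lift ord0 i).
Proof.
apply/subsetP => _ /imsetP[_ /porbitP[m ->] ->].
elim: m => [|m IHm]; first by rewrite perm1 porbit_id.
rewrite expgSr permM; set k := (t ^+ m)%g i in IHm *.
rewrite -eq_porbit_mem in IHm; rewrite -(eqP IHm).
(* One step of [t] from [k] becomes one step of the new permutation, or two if it passes through
   [ord0]. *)
have := mem_porbit (insert_perm t j) 1 (lift ord0 k).
have := mem_porbit (insert_perm t j) 2 (lift ord0 k).
rewrite expgS expg1 permM insert_perm_lift.
by case: eqP => // -> ; rewrite insert_perm0.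
Qed.

Lemma porbit_closed t i k : k \in porbit t i -> t k \in porbit t i.
Proof. by rewrite -!eq_porbit_mem -[t k]/((t ^+ 1)%g k) porbit_perm. Qed.

Lemma porbit_insert_id t i :
  porbit (insert_perm t ord0) (lift ord0 i) = lift ord0 @: porbit t i.
Proof.
apply/eqP; rewrite eqEsubset lift_porbit_insert andbT.
apply: porbit_sub => [|_ /imsetP[k ik ->]]; first by rewrite imset_f ?porbit_id.
by rewrite insert_perm_lift eq_sym (negPf (neq_lift _ _)) imset_f ?porbit_closed.
Qed.

Lemma porbit_insert_id0 t : porbit (insert_perm t ord0) ord0 = [set ord0].
Proof.
apply/eqP; rewrite eqEsubset sub1set porbit_id andbT.
by apply: porbit_sub => [|_ /set1P->]; rewrite ?insert_perm0 inE.
Qed.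

Lemma porbit_insert_disjoint t k i : k \notin porbit t i ->
  porbit (insert_perm t (lift ord0 k)) (lift ord0 i) = lift ord0 @: porbit t i.
Proof.
move=> ki; apply/eqP; rewrite eqEsubset lift_porbit_insert andbT.
apply: porbit_sub => [|_ /imsetP[m im ->]]; first by rewrite imset_f ?porbit_id.
rewrite insert_perm_lift (inj_eq lift_inj); case: eqP => [eq_k|_].
  by rewrite -eq_k porbit_closed in ki.
by rewrite imset_f ?porbit_closed.
Qed.

Lemma porbit_insert0 t k :
  porbit (insert_perm t (lift ord0 k)) ord0 = ord0 |: lift ord0 @: porbit t k.
Proof.
set s := insert_perm _ _; apply/eqP; rewrite eqEsubset; apply/andP; split.
  apply: porbit_sub => [|i]; first by rewrite setU11.
  case/setU1P => [->|/imsetP[m km ->]]; first last.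
    rewrite insert_perm_lift; case: ifP => _; first exact: setU11.
    by rewrite setU1r // imset_f ?porbit_closed.
  by rewrite insert_perm0 setU1r // imset_f ?porbit_id.
rewrite subUset sub1set porbit_id /=.
have /eqP <- : porbit s (lift ord0 k) == porbit s ord0.
  rewrite eq_porbit_mem -(insert_perm0 t (lift ord0 k)).
  exact: (mem_porbit s 1).
exact: lift_porbit_insert.
Qed.

Lemma porbit_insert t k i : k \in porbit t i ->
  porbit (insert_perm t (lift ord0 k)) (lift ord0 i) =
  ord0 |: lift ord0 @: porbit t i.
Proof.
move=> ki; have eq_ki : porbit t k = porbit t i.
  by apply/eqP; rewrite eq_porbit_mem.
rewrite -eq_ki -porbit_insert0; apply/eqP; rewrite eq_porbit_mem porbit_insert0.
by rewrite setU1r // imset_f // porbit_sym.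
Qed.

Lemma sizes_insert_id t :
  perm_eq (orbit_sizes (insert_perm t ord0)) (1 :: orbit_sizes t).
Proof.
apply: orbit_sizes_perm => [|m].
  by rewrite inE (negPf (orbit_sizes_gt0 t)).
rewrite big_ord_recl porbit_insert_id0 cards1 /= mulnDr.
congr (_ + _); first by case: eqP => [<-|_]; rewrite ?muln0.
under eq_bigr do rewrite porbit_insert_id (card_imset _ lift_inj).
rewrite (sum_orbit_sizes t (fun a : nat => (a == m) : nat)) -sumn_count sumnE.
rewrite big_map big_distrr; apply: eq_bigr => k _ /=.
by case: eqP => [->|_]; rewrite ?muln0.
Qed.

(** The cycle of [k] absorbs the new point and grows from [c] to [c.+1]; every other cycle is
    carried over by [lift ord0]. *)
Lemma sizes_insert t k : let c := #|porbit t k| in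
  perm_eq (orbit_sizes (insert_perm t (lift ord0 k)))
          (c.+1 :: rem c (orbit_sizes t)).
Proof.
move=> /=; set c := #|_|; have ct : c \in orbit_sizes t.
  by apply: map_f; rewrite mem_enum imset_f.
apply: orbit_sizes_perm => [|m].
  rewrite inE /=; apply: contra (orbit_sizes_gt0 t); exact: mem_rem.
have card_lift i : #|ord0 |: lift ord0 @: porbit t i| = #|porbit t i|.+1.
  rewrite cardsU1 (card_imset _ lift_inj); case: imsetP => // -[j _ /eqP].
  by rewrite (negPf (neq_lift _ _)).
rewrite big_ord_recl porbit_insert0 card_lift -/c.
rewrite (bigID (mem (porbit t k))) /=.
have -> : \sum_(i in porbit t k)
    (#|porbit (insert_perm t (lift ord0 k)) (lift ord0 i)| == m)
   = c * (c.+1 == m).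
  rewrite -sum_nat_const; apply: eq_bigr => i ki.
  rewrite porbit_insert ?card_lift; last by rewrite porbit_sym.
  by move: ki; rewrite -eq_porbit_mem => /eqP->.
have -> : \sum_(i | i \notin porbit t k)
    (#|porbit (insert_perm t (lift ord0 k)) (lift ord0 i)| == m)
   = \sum_(i | i \notin porbit t k) (#|porbit t i| == m).
  apply: eq_bigr => i ki.
  by rewrite porbit_insert_disjoint ?(card_imset _ lift_inj) // porbit_sym.
have : \sum_i (#|porbit t i| == m) = m * count_mem m (orbit_sizes t).
  rewrite (sum_orbit_sizes t (fun a : nat => (a == m) : nat)) -sumn_count sumnE.
  rewrite big_map big_distrr; apply: eq_bigr => i _ /=.
  by case: eqP => [->|_]; rewrite ?muln0.
rewrite (bigID (mem (porbit t k))) /= (seq.permP (perm_to_rem ct)) /=.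
have -> : \sum_(i in porbit t k) (#|porbit t i| == m) = c * (c == m).
  rewrite -sum_nat_const; apply: eq_bigr => i.
  by rewrite -eq_porbit_mem => /eqP->.
(* The new point and the [c] points of the old cycle make up the [c.+1] points counted when
   [m = c.+1]; the [c] old points disappear from the count at [m = c]. *)
by rewrite !mulnDr; case: (c =P m) => ?; case: (c.+1 =P m) => ?; lia.
Qed.

(** The image of [ord0] recovers [j], and cancelling the transposition then recovers [t]; the
    cardinalities agree because (n+1)! = (n+1) n!. *)
Lemma insert_perm_bij :
  bijective (fun p : 'S_n * 'I_n.+1 => insert_perm p.1 p.2).
Proof.
apply: inj_card_bij => [[t1 j1] [t2 j2] /= eq_s|].
  have eq_j : j1 = j2.
    by rewrite -(insert_perm0 t1 j1) eq_s insert_perm0.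
  rewrite -eq_j in eq_s *; congr (_, _); apply/permP => i.
  apply: (@lift_inj _ ord0); rewrite -(lift_perm_lift ord0 ord0 t1).
  by rewrite (mulIg _ _ _ eq_s) lift_perm_lift.
by rewrite card_prod card_ord -!cardsT !cardsE !(card_Sn) factS mulnC.
Qed.

End InsertPerm.

(** * Enumeration of the cycle types with their multiplicities *)

Fixpoint tally_add (x : nat * seq nat) (tl : seq (nat * seq nat)) :=
  if tl is y :: tl' then
    if x.2 == y.2 then (x.1 + y.1, y.2) :: tl' else y :: tally_add x tl'
  else [:: x].

(** A cycle of length [k] offers [k] insertion places, hence the factor [k]. Sorting gives each type
    a normal form, so that [tally_add] can merge equal types by comparing lists. *)
Definition cycle_type_step (x : nat * seq nat) : seq (nat * seq nat) :=
  (x.1, sort leq (1 :: x.2)) ::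
  [seq (x.1 * k, sort leq (k.+1 :: rem k x.2)) | k <- x.2].

(* The cycle types of the permutations of [n] points, as increasing sequences,
   each with the number of permutations of this type. *)
Fixpoint cycle_types (n : nat) : seq (nat * seq nat) :=
  if n is m.+1 then
    foldr tally_add [::] (flatten (map cycle_type_step (cycle_types m)))
  else [:: (1, [::])].

Section CycleTypeSum.
Variables (V : nmodType) (F : seq nat -> V).
Local Open Scope ring_scope.

Lemma big_tally_add x tl :
  \sum_(y <- tally_add x tl) F y.2 *+ y.1 = \sum_(y <- x :: tl) F y.2 *+ y.1.
Proof.
elim: tl => //= y tl IHtl; case: eqP => [eq_xy|_].
  by rewrite !big_cons /= addrA mulrnDr eq_xy.
by rewrite !big_cons IHtl big_cons addrCA.
Qed.

Lemma big_tally tl :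
  \sum_(y <- foldr tally_add [::] tl) F y.2 *+ y.1
    = \sum_(y <- tl) F y.2 *+ y.1.
Proof. by elim: tl => //= x tl IHtl; rewrite big_tally_add !big_cons IHtl. Qed.

End CycleTypeSum.

Lemma sort_leq_perm (l1 l2 : seq nat) :
  perm_eq l1 l2 -> sort leq l1 = sort leq l2.
Proof. exact/perm_sortP/anti_leq/leq_trans/leq_total. Qed.

(** By induction: [insert_perm_bij] turns a sum over the larger symmetric group into a double sum
    over [t] and [j], and the inner sum depends only on the cycle type of [t]. *)
Lemma big_cycle_types (V : nmodType) n (F : seq nat -> V) :
  (\sum_(s : 'S_n) F (sort leq (orbit_sizes s))
    = \sum_(x <- cycle_types n) F x.2 *+ x.1)%R.
Proof.
elim: n F => [|n IHn] F.
  rewrite big_seq1 /= mulr1n (big_pred1 1%g) => [|s]; last first.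
    by rewrite (permS0 s); apply/esym/eqP.
  congr F; rewrite /orbit_sizes (_ : porbits _ = set0) ?enum_set0 //.
  by apply/setP => C; rewrite inE; apply/imsetP => -[[]].
rewrite (reindex _ (onW_bij _ (@insert_perm_bij n))) /=.
rewrite -(pair_big xpredT xpredT
  (fun t j => F (sort leq (orbit_sizes (insert_perm t j))))) /=.
(* [G l] is the total contribution of all insertions into one permutation of type [l]; the induction
   hypothesis is applied to [G] in place of [F]. *)
pose G (l : seq nat) : V := (\sum_(x <- cycle_type_step (1, l)) F x.2 *+ x.1)%R.
transitivity (\sum_(t : 'S_n) G (sort leq (orbit_sizes t)))%R.
  apply: eq_bigr => t _; rewrite big_ord_recl /G /cycle_type_step /=.
  rewrite big_cons mulr1n /=; congr (_ + _)%R.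
    congr F; apply: sort_leq_perm.
    by rewrite (permPl (sizes_insert_id t)) perm_cons perm_sym perm_sort.
  rewrite big_map /=.
  under [RHS]eq_bigr do rewrite mul1n.
  rewrite (perm_big (orbit_sizes t)) /=; last by rewrite perm_sort.
  rewrite -(big_orbit_sizes t
    (fun k => F (sort leq (k.+1 :: rem k (sort leq (orbit_sizes t)))))).
  apply: eq_bigr => k _; congr F; apply: sort_leq_perm.
  rewrite (permPl (sizes_insert t k)) perm_cons; set c := #|_|.
  have ct : c \in orbit_sizes t by apply: map_f; rewrite mem_enum imset_f.
  (* Putting [c] back on both sides reduces the claim to a list being a rearrangement of its sorted
     copy. *)
  rewrite -(perm_cons c) -(permPl (perm_to_rem ct)).
  rewrite perm_sym -(permPl (perm_to_rem _)) ?mem_sort //.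
  by rewrite perm_sort.
rewrite IHn /= big_tally big_flatten big_map; apply: eq_bigr => -[c l] _.
rewrite /G /cycle_type_step !big_cons !big_map /= mulr1n mulrnDl -sumrMnl.
by congr (_ + _)%R; apply: eq_bigr => k _; rewrite mul1n mulnC mulrnA.
Qed.

(** * The action induced on [r]-subsets *)

Section InducedPerm.
Variables p r : nat.
Implicit Types s t : 'S_p.
Local Notation induced := (@induced_perm p r).

Lemma val_induced_perm s (S : rsubset p r) : val (induced s S) = s @: val S.
Proof. by rewrite permE SubK. Qed.

Lemma induced_permX s d : induced (s ^+ d)%g = (induced s ^+ d)%g.
Proof.
elim: d => [|d IHd]; apply/permP => S; apply: val_inj.
  rewrite val_induced_perm perm1 (eq_imset (g := id)) ?imset_id // => i.
  exact: perm1.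
rewrite !expgSr permM -IHd !val_induced_perm -imset_comp.
by apply: eq_imset => i; rewrite permM.
Qed.

(** If [s x] and [t x] differ, the point [y] with [s y = t x] is not [x]. An [r]-subset containing
    [x] but not [y] then has an image under [t] that contains [t x], and an image under [s] that
    does not. *)
Lemma induced_perm_inj : 0 < r < p -> injective induced.
Proof.
case/andP=> r0 rp s t eq_st; apply/permP => x; apply/eqP/negPn/negP => ne.
pose y := (s^-1)%g (t x).
have ne_xy : x != y by apply: contra ne => /eqP {1}->; rewrite permKV.
(* The other [r.-1] points are chosen among the [p - 2] points distinct from [x] and [y]; this is
   possible because [r < p]. *)
have : 0 < #|[set A : {set 'I_p} | A \subset ~: [set x; y] & #|A| == r.-1]|.
  by rewrite cards_draws bin_gt0 cardsCs setCK card_ord cards2 ne_xy; lia.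
case/card_gt0P => A; rewrite inE => /andP[/subsetP sA /eqP cA].
have xA : x \notin A by apply/negP => /sA; rewrite !inE eqxx.
have cS : #|x |: A| == r by rewrite cardsU1 xA cA add1n prednK.
have /(congr1 val) := congr1 (fun u : {perm _} => u (Sub (x |: A) cS)) eq_st.
rewrite !val_induced_perm !SubK => /setP/(_ (t x)).
rewrite [RHS]imset_f ?setU11 // -[t x](permKV s) mem_imset ?inE; last first.
  exact: perm_inj.
by rewrite -/y eq_sym (negPf ne_xy) => /sA; rewrite !inE eqxx orbT.
Qed.

Lemma card_fix_induced s d :
  #|[set S | (induced s ^+ d)%g S == S]|
    = subset_sums (power_sizes d (orbit_sizes s)) r.
Proof.
rewrite -(perm_subset_sums (power_sizesP s d)) -card_invariant_subsets.
rewrite -(card_imset _ val_inj); apply: eq_card => S; rewrite inE.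
apply/imsetP/andP => [[S']|[Sr sS]].
  rewrite inE => /eqP/(congr1 val).
  rewrite -induced_permX val_induced_perm => eqS ->.
  by rewrite (valP S') eqS.
exists (Sub S Sr); rewrite ?SubK // inE; apply/eqP/val_inj.
by rewrite -induced_permX val_induced_perm SubK; apply/eqP.
Qed.

End InducedPerm.

(** * Recovering cycle counts from fixed-point counts *)

(* Solves [f d = \sum_(k %| d) k * c k] for [c 1, ..., c n]. *)
Fixpoint divisor_sum_inv (f : nat -> nat) (n : nat) : seq nat :=
  if n is m.+1 then
    let c := divisor_sum_inv f m in
    rcons c ((f n - sumn [seq (k.+1 %| n) * (k.+1 * nth 0 c k) | k <- iota 0 m])
               %/ n)
  else [::].

Lemma size_divisor_sum_inv f n : size (divisor_sum_inv f n) = n.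
Proof. by elim: n => //= n IHn; rewrite size_rcons IHn. Qed.

(** The equation at [n] is triangular: it involves [c n] with coefficient [n] and otherwise only
    earlier values, so the subtraction and the division are exact. Position [k] holds [c k.+1]. *)
Lemma nth_divisor_sum_inv (f c : nat -> nat) n k :
    (forall d, 0 < d -> f d = \sum_(i < d) (i.+1 %| d) * (i.+1 * c i.+1)) ->
  k < n -> nth 0 (divisor_sum_inv f n) k = c k.+1.
Proof.
move=> Hf; elim: n k => //= n IHn k; rewrite ltnS => le_kn.
rewrite nth_rcons size_divisor_sum_inv; case: ltnP => [/IHn//|le_nk].
have -> : k = n by apply/eqP; rewrite eqn_leq le_kn.
rewrite eqxx Hf // big_ord_recr /= dvdnn mul1n sumnE big_map.
rewrite -[X in iota 0 X]subn0 -/(index_iota 0 n) big_mkord.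
under [X in _ - X]eq_bigr do rewrite IHn //.
by rewrite addKn mulKn.
Qed.

(** Regroups the fixed points of the power by cycle length, in the form that [divisor_sum_inv]
    solves; since [d] is positive, its divisors are at most [d]. *)
Lemma card_fixX_cycle_count (T : finType) (u : {perm T}) d : 0 < d ->
  #|[set x | (u ^+ d)%g x == x]|
    = \sum_(i < d) (i.+1 %| d) * (i.+1 * cycle_count u i.+1).
Proof.
move=> d0; rewrite card_fixX.
under [RHS]eq_bigr do rewrite cycle_countE.
elim: (orbit_sizes u) (orbit_sizes_gt0 u) => [|k l IHl].
  by rewrite big_nil big1 // => i _; rewrite !muln0.
rewrite inE negb_or big_cons => /andP[k0 /IHl->].
rewrite [RHS](eq_bigr (fun i : 'I_d => (i.+1 %| d) * (i.+1 * (k == i.+1)) +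
    (i.+1 %| d) * (i.+1 * count_mem i.+1 l))) => [|i _]; last first.
  rewrite -[count_mem i.+1 (k :: l)]/((k == i.+1) + count_mem i.+1 l).
  by rewrite !mulnDr.
rewrite big_split /=; case: ifP => [kd|nkd]; last first.
  rewrite [X in X + _]big1 // => i _.
  by case: (k =P i.+1) => [<-|_]; rewrite ?nkd ?muln0.
congr (_ + _).
have k_gt0 : 0 < k by rewrite lt0n eq_sym.
have kE : k.-1.+1 = k by exact: prednK.
have lt_kd : k.-1 < d by rewrite kE; exact: dvdn_leq.
rewrite (bigD1 (Ordinal lt_kd)) //= kE kd eqxx mul1n muln1 big1 ?addn0 // => i.
case: (k =P i.+1) => [ki|_ _]; last by rewrite !muln0.
by case/eqP; apply: val_inj => /=; rewrite ki.
Qed.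

(** The least common multiple of the cycle lengths is the order of the permutation; no cycle on
    [r]-subsets is longer, so solving up to this bound finds every cycle. *)
Definition rsubset_cycle_counts (r : nat) (l : seq nat) : seq nat :=
  divisor_sum_inv (fun d => subset_sums (power_sizes d l) r) (foldr lcmn 1 l).

Lemma perm_power_sizes d l1 l2 :
  perm_eq l1 l2 -> perm_eq (power_sizes d l1) (power_sizes d l2).
Proof. by move=> eq_l; apply/perm_flatten/perm_map. Qed.

Lemma foldr_lcmn_gt0 (l : seq nat) : 0 \notin l -> 0 < foldr lcmn 1 l.
Proof.
elim: l => //= k l IHl; rewrite inE negb_or => /andP[k0 /IHl l0].
by rewrite lcmn_gt0 l0 lt0n eq_sym k0.
Qed.

Lemma dvdn_foldr_lcmn (l : seq nat) k : k \in l -> k %| foldr lcmn 1 l.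
Proof.
elim: l => //= m l IHl /predU1P[->|/IHl kl]; first exact: dvdn_lcml.
exact: dvdn_trans kl (dvdn_lcmr _ _).
Qed.

Lemma cycle_count_gt (T : finType) (u : {perm T}) N k :
  0 < N -> (u ^+ N = 1)%g -> N < k -> cycle_count u k = 0.
Proof.
move=> N0 uN Nk; rewrite cycle_countE; apply/count_memPn/mapP => -[C].
rewrite mem_enum => /imsetP[x _ ->] kx; move: Nk; rewrite kx ltnNge dvdn_leq //.
by rewrite -permX_fix uN perm1.
Qed.

Lemma cycle_count_gt_card (T : finType) (u : {perm T}) k :
  #|T| < k -> cycle_count u k = 0.
Proof.
move=> Tk; rewrite cycle_countE; apply/count_memPn/mapP => -[C] _ kC.
by move: Tk; rewrite kC ltnNge max_card.
Qed.

Lemma permX_lcmn (T : finType) (s : {perm T}) l :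
  perm_eq (orbit_sizes s) l -> (s ^+ foldr lcmn 1%N l = 1)%g.
Proof.
move=> eq_l; apply/permP => x; apply/eqP; rewrite perm1 permX_fix.
by apply: dvdn_foldr_lcmn; rewrite -(perm_mem eq_l) map_f // mem_enum imset_f.
Qed.

(** * Cycle monomials and the cycle index of the [r]-group *)

Local Open Scope ring_scope.

Definition cycle_monomial (c : seq nat) : {malg rat[{cmonom nat}]} :=
  \prod_(k < size c) 'a_(k.+1) ^+ nth 0%N c k.

(** Beyond either bound all exponents vanish, so the two products differ only by factors equal to
    1. *)
Lemma cycle_monomialP (T : finType) (u : {perm T}) N :
    (forall k, N < k -> cycle_count u k = 0)%N ->
  \prod_(1 <= k < #|T|.+1) 'a_k ^+ cycle_count u k =
  \prod_(k < N) 'a_(k.+1) ^+ cycle_count u k.+1.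
Proof.
pose f k := 'a_(k.+1) ^+ cycle_count u k.+1.
move=> uN; rewrite -(big_mkord xpredT f) big_add1 /=.
have trunc a b : (a <= b)%N -> (forall k, a < k -> cycle_count u k = 0)%N ->
    \prod_(0 <= k < a) f k = \prod_(0 <= k < b) f k.
  move=> ab ua; rewrite [RHS](big_cat_nat (n := a)) //=.
  rewrite [X in _ * X]big_nat_cond [X in _ * X]big1 ?mulr1 // => k.
  by rewrite andbT => /andP[ak _]; rewrite /f ua.
case: (leqP N #|T|) => [NT|/ltnW TN]; first by rewrite (trunc N #|T|).
by rewrite -(trunc #|T| N) // => k; apply: cycle_count_gt_card.
Qed.

Lemma induced_cycle_monomial p r (s : 'S_p) l : perm_eq (orbit_sizes s) l ->
  \prod_(1 <= k < #|{: rsubset p r}|.+1)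
      'a_k ^+ cycle_count (@induced_perm p r s) k
    = cycle_monomial (rsubset_cycle_counts r l).
Proof.
move=> eq_l; set N := foldr lcmn 1%N l.
have N0 : (0 < N)%N.
  by apply: foldr_lcmn_gt0; rewrite -(perm_mem eq_l) orbit_sizes_gt0.
rewrite (@cycle_monomialP _ _ N) => [|k].
  rewrite /cycle_monomial /rsubset_cycle_counts size_divisor_sum_inv.
  apply: eq_bigr => k _; congr (_ ^+ _).
  apply/esym/nth_divisor_sum_inv => // d d0.
  rewrite -card_fixX_cycle_count // card_fix_induced.
  by apply/esym/perm_subset_sums/perm_power_sizes.
apply: cycle_count_gt => //; rewrite -induced_permX permX_lcmn //.
(* At exponent 0 the power law says that the identity induces the identity. *)
exact: (induced_permX r s 0).
Qed.

(** Injectivity of the induced action gives the group order [p!] and turns the sum over the group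
    into a sum over all of ['S_p], which is then grouped by cycle type. *)
Theorem cycle_index_rgroup p r : (0 < r < p)%N ->
  cycle_index (rgroup p r) =
  (p`!%:R : rat)^-1 *:
    \sum_(x <- cycle_types p)
      cycle_monomial (rsubset_cycle_counts r x.2) *+ x.1.
Proof.
move=> rp; have inj := induced_perm_inj rp.
have card_rgroup : #|rgroup p r| = p`!.
  by rewrite -card_Sn -[RHS]cardsT; apply: card_imset.
rewrite /cycle_index card_rgroup.
rewrite (big_imset (h := @induced_perm p r)) /=; last exact: in2W.
rewrite -(big_cycle_types p
  (fun l => cycle_monomial (rsubset_cycle_counts r l))).
congr (_ *: _); apply: eq_big => [s|s _]; first by rewrite inE.
by apply: induced_cycle_monomial; rewrite perm_sym perm_sort.
Qed.

Definition cycle_support (c : seq nat) : seq (nat * nat) :=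
  [seq x <- [seq (k.+1, nth 0%N c k) | k <- iota 0 (size c)] | x.2 != 0%N].

Lemma cycle_monomialE c :
  cycle_monomial c = \prod_(x <- cycle_support c) 'a_(x.1) ^+ x.2.
Proof.
rewrite /cycle_monomial /cycle_support big_filter big_map /=.
rewrite -[X in iota 0 X]subn0 -/(index_iota 0 (size c)) big_mkord.
by rewrite [RHS]big_mkcond; apply: eq_bigr => k _; case: eqP => [->|].
Qed.

(* The right-hand side unfolds to a left-associated sum of left-associated
   products. *)
Lemma sum_foldl (R : pzSemiRingType) (I : Type) (s : seq (seq I * nat))
    (f : I -> R) :
  \sum_(x <- s) (\prod_(i <- x.1) f i) *+ x.2 =
  foldl (fun y x => y + foldl (fun z i => z * f i) x.2%:R x.1) 0 s.
Proof.
have prodE z (t : seq I) :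
    foldl (fun z i => z * f i) z t = z * \prod_(i <- t) f i.
  elim: t z => [|i t IHt] z /=; first by rewrite big_nil mulr1.
  by rewrite IHt big_cons mulrA.
rewrite -[LHS]add0r; move: {1 3}0 => y.
elim: s y => [|x s IHs] y /=; first by rewrite big_nil addr0.
by rewrite -IHs big_cons addrA prodE mulr_natl.
Qed.

(** * Evaluation for the 4-subsets of 9 points *)

Local Open Scope nat_scope.

(** One row for each of the 30 partitions of 9: the pairs of variable index and exponent, then the
    number of permutations. *)
Definition terms_9_4 : seq (seq (nat * nat) * nat) :=
  [:: ([:: (1, 126)], 1);
      ([:: (1, 56); (2, 35)], 36);
      ([:: (1, 26); (2, 50)], 378);
      ([:: (1, 21); (3, 35)], 168);
      ([:: (1, 12); (2, 57)], 1260);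
      ([:: (1, 11); (2, 5); (3, 15); (6, 10)], 2520);
      ([:: (1, 6); (2, 60)], 945);
      ([:: (1, 6); (2, 10); (4, 25)], 756);
      ([:: (1, 6); (3, 40)], 3360);
      ([:: (1, 5); (2, 8); (3, 7); (6, 14)], 7560);
      ([:: (1, 4); (2, 11); (4, 25)], 7560);
      ([:: (1, 3); (2, 1); (3, 1); (4, 4); (6, 3); (12, 7)], 15120);
      ([:: (1, 3); (2, 9); (3, 3); (6, 16)], 2520);
      ([:: (1, 2); (2, 12); (4, 25)], 11340);
      ([:: (1, 2); (2, 2); (3, 18); (6, 11)], 10080);
      ([:: (1, 2); (2, 2); (4, 30)], 11340);
      ([:: (1, 1); (5, 5); (10, 10)], 9072);
      ([:: (1, 1); (5, 11); (10, 7)], 18144);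
      ([:: (1, 1); (5, 1); (10, 2); (20, 5)], 18144);
      ([:: (1, 1); (2, 2); (3, 1); (4, 4); (6, 3); (12, 7)], 15120);
      ([:: (1, 1); (5, 4); (15, 7)], 24192);
      ([:: (1, 1); (5, 25)], 3024);
      ([:: (7, 8); (14, 5)], 25920);
      ([:: (2, 3); (3, 4); (6, 18)], 10080);
      ([:: (2, 3); (3, 2); (6, 19)], 30240);
      ([:: (2, 1); (4, 1); (8, 15)], 45360);
      ([:: (3, 42)], 2240);
      ([:: (3, 4); (6, 19)], 20160);
      ([:: (7, 18)], 25920);
      ([:: (9, 14)], 40320)].

Lemma terms_9_4P :
  perm_eq [seq (cycle_support (rsubset_cycle_counts 4 x.2), x.1)
          | x <- cycle_types 9] terms_9_4.
Proof. by vm_compute. Qed.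

Local Open Scope ring_scope.

Theorem mainTheorem7 :
  cycle_index (rgroup 9 4) =
  (9`!%:R : rat)^-1 *: (
    'a_1 ^+ 126
  + 36%:R * 'a_1 ^+ 56 * 'a_2 ^+ 35
  + 378%:R * 'a_1 ^+ 26 * 'a_2 ^+ 50
  + 168%:R * 'a_1 ^+ 21 * 'a_3 ^+ 35
  + 1260%:R * 'a_1 ^+ 12 * 'a_2 ^+ 57
  + 2520%:R * 'a_1 ^+ 11 * 'a_2 ^+ 5 * 'a_3 ^+ 15 * 'a_6 ^+ 10
  + 945%:R * 'a_1 ^+ 6 * 'a_2 ^+ 60
  + 756%:R * 'a_1 ^+ 6 * 'a_2 ^+ 10 * 'a_4 ^+ 25
  + 3360%:R * 'a_1 ^+ 6 * 'a_3 ^+ 40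
  + 7560%:R * 'a_1 ^+ 5 * 'a_2 ^+ 8 * 'a_3 ^+ 7 * 'a_6 ^+ 14
  + 7560%:R * 'a_1 ^+ 4 * 'a_2 ^+ 11 * 'a_4 ^+ 25
  + 15120%:R * 'a_1 ^+ 3 * 'a_2 * 'a_3 * 'a_4 ^+ 4 * 'a_6 ^+ 3 * 'a_12 ^+ 7
  + 2520%:R * 'a_1 ^+ 3 * 'a_2 ^+ 9 * 'a_3 ^+ 3 * 'a_6 ^+ 16
  + 11340%:R * 'a_1 ^+ 2 * 'a_2 ^+ 12 * 'a_4 ^+ 25
  + 10080%:R * 'a_1 ^+ 2 * 'a_2 ^+ 2 * 'a_3 ^+ 18 * 'a_6 ^+ 11
  + 11340%:R * 'a_1 ^+ 2 * 'a_2 ^+ 2 * 'a_4 ^+ 30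
  + 9072%:R * 'a_1 * 'a_5 ^+ 5 * 'a_10 ^+ 10
  + 18144%:R * 'a_1 * 'a_5 ^+ 11 * 'a_10 ^+ 7
  + 18144%:R * 'a_1 * 'a_5 * 'a_10 ^+ 2 * 'a_20 ^+ 5
  + 15120%:R * 'a_1 * 'a_2 ^+ 2 * 'a_3 * 'a_4 ^+ 4 * 'a_6 ^+ 3 * 'a_12 ^+ 7
  + 24192%:R * 'a_1 * 'a_5 ^+ 4 * 'a_15 ^+ 7
  + 3024%:R * 'a_1 * 'a_5 ^+ 25
  + 25920%:R * 'a_7 ^+ 8 * 'a_14 ^+ 5
  + 10080%:R * 'a_2 ^+ 3 * 'a_3 ^+ 4 * 'a_6 ^+ 18
  + 30240%:R * 'a_2 ^+ 3 * 'a_3 ^+ 2 * 'a_6 ^+ 19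
  + 45360%:R * 'a_2 * 'a_4 * 'a_8 ^+ 15
  + 2240%:R * 'a_3 ^+ 42
  + 20160%:R * 'a_3 ^+ 4 * 'a_6 ^+ 19
  + 25920%:R * 'a_7 ^+ 18
  + 40320%:R * 'a_9 ^+ 14
  ).
Proof.
rewrite cycle_index_rgroup; last by [].
apply: (congr1 (fun y => _ *: y)).
pose f (x : nat * nat) := 'a_(x.1) ^+ x.2.
rewrite (eq_bigr (fun x =>
    (\prod_(i <- cycle_support (rsubset_cycle_counts 4 x.2)) f i) *+ x.1));
  last by move=> x _; rewrite cycle_monomialE.
rewrite -(big_map (fun x => (cycle_support (rsubset_cycle_counts 4 x.2), x.1))
  xpredT (fun x => (\prod_(i <- x.1) f i) *+ x.2)).
rewrite (perm_big _ terms_9_4P) sum_foldl /terms_9_4 /f.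
(* [simpl] would expand the large numerals. *)
cbn [foldl fst snd].
(* Only the initial 0 of the sum and the coefficient 1 of the first term remain to be removed; first
   powers agree with the bare variables by conversion. *)
by rewrite add0r mulr1n mul1r.
Qed.
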